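(* Let $\nu\ge 3$ and $\nu+4\le m\le 2^\nu-1$. Then there exists an extended affine root system $R=R(A_1,S)$ of type $A_1$ and nullity $\nu$ with $\mathrm{ind}(S)=m$ such that its extended affine Weyl group does not have the presentation by conjugation.
   Context: Semilattices. Let $\mathcal V^0$ be a finite dimensional real vector space of dimension $\nu$. A semilattice in $\mathcal V^0$ is a subset $S\subseteq\mathcal V^0$ such that $0\in S$, $S\pm 2S\subseteq S$, $S$ spans $\mathcal V^0$ and $S$ is discrete in $\mathcal V^0$. The $\mathbb Z$-span $\Lambda$ of $S$ is a lattice in $\mathcal V^0$ having a $\mathbb Z$-basis contained in $S$; fix such a basis $\{\sigma_1,\ldots,\sigma_\nu\}\subseteq S$. For $J\subseteq J_\nu:=\{1,\ldots,\nu\}$ put $\tau_J:=\sum_{j\in J}\sigma_j$ ($\tau_\emptyset=0$). $\mathrm{supp}(S)$ is the unique collection of subsets of $J_\nu$ with $\emptyset\in\mathrm{supp}(S)$ and $S=\bigcup_{J\in\mathrm{supp}(S)}(\tau_J+2\Lambda)$. Put $\mathrm{ind}(S)=|\mathrm{supp}(S)|-1$ (the index of $S$). Root system and Weyl group. Let $\mathcal V=\mathbb R\alpha_1\oplus\mathcal V^0$ with the positive semi-definite symmetric bilinear form having radical $\mathcal V^0$ and $(\alpha_1,\alpha_1)=2$. The extended affine root system $R=R(A_1,S)$ of type $A_1$ and nullity $\nu$ is $R=(S+S)\cup(\pm\alpha_1+S)$, with $S$ a semilattice in $\mathcal V^0$, and $R^\times=\pm\alpha_1+S$ is its set of non-isotropic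 elements. Let $\tilde{\mathcal V}=\mathcal V\oplus(\mathcal V^0)^*$ with the non-degenerate symmetric form extending that of $\mathcal V$ such that $(\alpha_1,(\mathcal V^0)^* )=((\mathcal V^0)^*,(\mathcal V^0)^* )=0$ and $(\sigma_i,\lambda_j)=\delta_{i,j}$ for a basis $\{\lambda_1,\ldots,\lambda_\nu\}$ of $(\mathcal V^0)^*$. The extended affine Weyl group $\mathcal W$ is the subgroup of the orthogonal group of $\tilde{\mathcal V}$ generated by the reflections $w_\alpha(u)=u-(u,\alpha)\alpha$, $\alpha\in R^\times$. Presentation by conjugation. $\hat{\mathcal W}$ is the group with generators $\hat w_\alpha$, $\alpha\in R^\times$, and relations $\hat w_\alpha^2=1$ and $\hat w_\alpha\hat w_\beta\hat w_\alpha=\hat w_{w_\alpha(\beta)}$ ($\alpha,\beta\in R^\times$). $\mathcal W$ has the presentation by conjugation if $\mathcal W\cong\hat{\mathcal W}$. *)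

(* Defs.v *)
From HB Require Import structures.
From mathcomp Require Import all_boot all_order all_algebra.
From mathcomp Require Import generic_quotient.
From mathcomp Require Import all_classical all_reals all_analysis.
From mathcomp Require Import ring.

Set Implicit Arguments.
Unset Strict Implicit.
Unset Printing Implicit Defensive.

Import Order.TTheory GRing.Theory Num.Theory.
Import numFieldNormedType.Exports.

Local Open Scope classical_set_scope.
Local Open Scope ring_scope.
Local Open Scope quotient_scope.

Section Generated.
Variable G : groupType.

Definition is_subgroup (H : set G) : Prop :=
  H 1%g /\ forall x y, H x -> H y -> H (x / y)%g.

Definition generated (A : set G) : set G := smallest is_subgroup A.

Lemma generated_closed (A : set G) :
  group_closed [pred x | x \in generated A].
Proof.
split=> [|x y]; rewrite !inE.
  by move=> H [[H1 _] _].
by move=> gx gy H HA; case: (HA) => [[_ HB] _]; apply: HB; [exact: gx|exact: gy].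
Qed.

Record generated_group (A : set G) := GeneratedGroup
  { generated_val :> G; _ : [pred x | x \in generated A] generated_val }.

HB.instance Definition _ (A : set G) := [isSub for @generated_val A].
HB.instance Definition _ (A : set G) := [Choice of generated_group A by <:].
HB.instance Definition _ (A : set G) := SubChoice_isSubGroup.Build
  G [pred x | x \in generated A] (generated_group A) (generated_closed A).
End Generated.

(* Groups given by generators and relations.  A letter (x, b) stands for the  *)
(* generator x if b = false and for its inverse if b = true; a pair (u, v) of *)
(* words in rels stands for the relation u = v.                               *)
Section Presentation.
Variables (X : choiceType) (rels : set (seq (X * bool) * seq (X * bool))).
Let word := seq (X * bool).

Inductive word_eq : word -> word -> Prop :=
| word_eq_rel u v : rels (u, v) -> word_eq u v
| word_eq_cancel x b : word_eq [:: (x, b); (x, ~~ b)] [::]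
| word_eq_refl u : word_eq u u
| word_eq_sym u v : word_eq u v -> word_eq v u
| word_eq_trans u v w : word_eq u v -> word_eq v w -> word_eq u w
| word_eq_cat u u' v v' :
    word_eq u u' -> word_eq v v' -> word_eq (u ++ v) (u' ++ v').

Definition word_eqb : rel word := fun u v => `[< word_eq u v >].

Lemma word_eqb_equiv : equiv_class_of word_eqb.
Proof.
split=> [u|u v|v u w].
- by apply/asboolP; exact: word_eq_refl.
- by apply/asboolP/asboolP; exact: word_eq_sym.
- by move=> /asboolP uv /asboolP vw; apply/asboolP; exact: word_eq_trans vw.
Qed.

Canonical word_equiv := EquivRelPack word_eqb_equiv.

Definition presented := {eq_quot word_equiv}.

HB.instance Definition _ := Choice.on presented.
HB.instance Definition _ := EqQuotient.on presented.

Definition word_inv (u : word) : word := rev [seq (l.1, ~~ l.2) | l <- u].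

Lemma word_eq_mulV u : word_eq (u ++ word_inv u) [::].
Proof.
elim: u => [|[x b] u IH]; first exact: word_eq_refl.
rewrite /word_inv /= rev_cons -cats1 catA -/(word_inv u).
apply: word_eq_trans (word_eq_cancel x b).
apply: (@word_eq_cat ((x, b) :: u ++ word_inv u) [:: (x, b)]
  [:: (x, ~~ b)] [:: (x, ~~ b)]); last exact: word_eq_refl.
exact: (@word_eq_cat [:: (x, b)] [:: (x, b)] _ _ (word_eq_refl _) IH).
Qed.

Lemma word_invK : involutive word_inv.
Proof.
move=> u; rewrite /word_inv -map_rev revK -map_comp -[RHS]map_id.
by apply: eq_map => -[x b] /=; rewrite negbK.
Qed.

Lemma word_eq_Vmul u : word_eq (word_inv u ++ u) [::].
Proof. by rewrite -{2}(word_invK u); exact: word_eq_mulV. Qed.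

Lemma word_inv_cat u v : word_inv (u ++ v) = word_inv v ++ word_inv u.
Proof. by rewrite /word_inv map_cat rev_cat. Qed.

Lemma word_eq_inv u v : word_eq u v -> word_eq (word_inv u) (word_inv v).
Proof.
move=> uv; apply: (@word_eq_trans _ (word_inv u ++ (v ++ word_inv v))).
  rewrite -{1}[word_inv u]cats0; apply: word_eq_cat (word_eq_refl _) _.
  exact/word_eq_sym/word_eq_mulV.
apply: (@word_eq_trans _ (word_inv u ++ u ++ word_inv v)).
  apply: word_eq_cat (word_eq_refl _) _.
  by apply: word_eq_cat (word_eq_refl _); exact: word_eq_sym.
rewrite catA -[X in word_eq _ X]cat0s.
exact: word_eq_cat (word_eq_Vmul _) (word_eq_refl _).
Qed.

Lemma pi_word_eq u v : word_eq u v <-> \pi_presented u = \pi_presented v.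
Proof.
by split=> [uv|/eqquotP /asboolP //]; apply/eqquotP/asboolP.
Qed.

Lemma repr_word_eq u : word_eq (repr (\pi_presented u)) u.
Proof. by apply/pi_word_eq; rewrite reprK. Qed.

Definition pmul (a b : presented) : presented :=
  \pi_presented (repr a ++ repr b).
Definition pone : presented := \pi_presented [::].
Definition pinv (a : presented) : presented :=
  \pi_presented (word_inv (repr a)).

Lemma pmulA : associative pmul.
Proof.
move=> a b c; apply/pi_word_eq.
apply: (@word_eq_trans _ (repr a ++ repr b ++ repr c)).
  exact: word_eq_cat (word_eq_refl _) (repr_word_eq _).
rewrite catA; apply: word_eq_cat (word_eq_refl _).
exact/word_eq_sym/repr_word_eq.
Qed.

Lemma pmul1 : left_id pone pmul.
Proof.
move=> a; rewrite -[RHS]reprK; apply/pi_word_eq.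
exact: (word_eq_cat (repr_word_eq [::]) (word_eq_refl _)).
Qed.

Lemma p1mul : right_id pone pmul.
Proof.
move=> a; rewrite -[RHS]reprK; apply/pi_word_eq.
rewrite -[X in word_eq _ X]cats0.
exact: (word_eq_cat (word_eq_refl _) (repr_word_eq [::])).
Qed.

Lemma pmulV : left_inverse pone pinv pmul.
Proof.
move=> a; apply/pi_word_eq; apply: word_eq_trans (word_eq_Vmul (repr a)).
exact: word_eq_cat (repr_word_eq _) (word_eq_refl _).
Qed.

Lemma pVmul : right_inverse pone pinv pmul.
Proof.
move=> a; apply/pi_word_eq; apply: word_eq_trans (word_eq_mulV (repr a)).
exact: word_eq_cat (word_eq_refl _) (repr_word_eq _).
Qed.

HB.instance Definition _ :=
  isGroup.Build presented pmulA pmul1 p1mul pmulV pVmul.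
End Presentation.

Section OrthogonalGroup.
Variables (K : fieldType) (V : vectType K) (B : V -> V -> K).

Definition isometry (f : 'End(V)) : Prop :=
  forall x y, B (f x) (f y) = B x y.

Record orthogonal_group := Orthogonal
  { orth_val :> 'End(V);
    _ : (lker orth_val == 0%VS) && `[< isometry orth_val >] }.

HB.instance Definition _ := [isSub for orth_val].
HB.instance Definition _ := [Choice of orthogonal_group by <:].

Lemma orth_ker (f : orthogonal_group) : lker (val f) == 0%VS.
Proof. by case/andP: (valP f). Qed.

Lemma orth_iso (f : orthogonal_group) : isometry (val f).
Proof. by case/andP: (valP f) => _ /asboolP. Qed.

Lemma orth_mul_subproof (f g : orthogonal_group) :
  (lker (val f \o val g)%VF == 0%VS) && `[< isometry (val f \o val g)%VF >].
Proof.
apply/andP; split; last first.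
  by apply/asboolP => x y; rewrite !comp_lfunE !orth_iso.
apply/lker0P => x y; rewrite !comp_lfunE.
by move=> /(lker0P (orth_ker f)) /(lker0P (orth_ker g)).
Qed.

Lemma orth_one_subproof :
  (lker (\1%VF : 'End(V)) == 0%VS) && `[< isometry \1%VF >].
Proof.
apply/andP; split; first by apply/lker0P => x y; rewrite !id_lfunE.
by apply/asboolP => x y; rewrite !id_lfunE.
Qed.

Lemma orth_inv_subproof (f : orthogonal_group) :
  (lker ((val f)^-1)%VF == 0%VS) && `[< isometry ((val f)^-1)%VF >].
Proof.
have fK := lker0_compfV (orth_ker f).
have fVK x : val f ((val f)^-1%VF x) = x.
  by rewrite -comp_lfunE fK id_lfunE.
apply/andP; split; last first.
  by apply/asboolP => x y; rewrite -(orth_iso f) !fVK.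
by apply/lker0P => x y /(congr1 (val f)); rewrite !fVK.
Qed.

Definition orth_mul (f g : orthogonal_group) : orthogonal_group :=
  Orthogonal (orth_mul_subproof f g).
Definition orth_one : orthogonal_group := Orthogonal orth_one_subproof.
Definition orth_inv (f : orthogonal_group) : orthogonal_group :=
  Orthogonal (orth_inv_subproof f).

Lemma orth_mulA : associative orth_mul.
Proof. by move=> f g h; apply: val_inj; rewrite /= comp_lfunA. Qed.
Lemma orth_mul1 : left_id orth_one orth_mul.
Proof. by move=> f; apply: val_inj; rewrite /= comp_lfun1l. Qed.
Lemma orth_1mul : right_id orth_one orth_mul.
Proof. by move=> f; apply: val_inj; rewrite /= comp_lfun1r. Qed.
Lemma orth_mulV : left_inverse orth_one orth_inv orth_mul.
Proof. by move=> f; apply: val_inj; rewrite /= lker0_compVf ?orth_ker. Qed.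
Lemma orth_Vmul : right_inverse orth_one orth_inv orth_mul.
Proof. by move=> f; apply: val_inj; rewrite /= lker0_compfV ?orth_ker. Qed.

HB.instance Definition _ := isGroup.Build orthogonal_group
  orth_mulA orth_mul1 orth_1mul orth_mulV orth_Vmul.

Lemma orth_mulE (f g : orthogonal_group) : val (f * g)%g =1 val f \o val g.
Proof. by move=> x; rewrite /= comp_lfunE. Qed.

Lemma orth_oneE : val (1%g : orthogonal_group) =1 id.
Proof. by move=> x; rewrite /= id_lfunE. Qed.

Definition reflection (a u : V) : V := u - B u a *: a.

Definition reflections (A : set V) : set orthogonal_group :=
  [set g | exists2 a, A a & orth_val g =1 reflection a].

(* reflections B A only collects the reflections that are isometries; with    *)
(* the formula u - B u a *: a this is the case when B a a = 2.                *)
Lemma reflection_orthogonal (a : V) :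
  (forall x y, B x y = B y x) -> (forall x, linear (B x : V -> K^o)) ->
  B a a = 2 -> exists g : orthogonal_group, orth_val g =1 reflection a.
Proof.
move=> BC Bl a2.
have fl u k x y : B u (k *: x + y) = k * B u x + B u y by exact: (Bl u).
have fB u k x : B u (x - k *: a) = B u x - k * B u a.
  by rewrite addrC -scaleNr fl mulNr addrC.
have rl : linear (reflection a).
  move=> k x y; rewrite /reflection BC fl -!(BC _ a) scalerDl opprD.
  by rewrite scalerBr scalerA addrACA.
pose r : {linear V -> V} :=
  HB.pack (reflection a) (GRing.isLinear.Build _ _ _ _ _ rl).
have rE : linfun r =1 reflection a by move=> x; rewrite lfunE.
have rI : isometry (linfun r).
  move=> x y; rewrite !rE /reflection fB BC fB [B (x - _) a]BC fB a2.
  by rewrite !(BC a) (BC y); ring.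
have rK : involutive (reflection a).
  move=> x; rewrite {1}/reflection [B (reflection _ _) a]BC fB a2.
  rewrite /reflection (BC a) -addrA -opprD -scalerDl.
  by rewrite [X in X *: _](_ : _ = 0) ?scale0r ?subr0//; ring.
have ok : (lker (linfun r) == 0%VS) && `[< isometry (linfun r) >].
  apply/andP; split; last exact/asboolP.
  by apply/lker0P => x y; rewrite !rE; exact: (inv_inj rK).
by exists (Orthogonal ok) => x; rewrite /= rE.
Qed.
End OrthogonalGroup.

Arguments reflection {K V} B a u.
Arguments reflections {K V} B A.

Definition isomorphic (G H : groupType) : Prop :=
  exists f : {multiplicative G -> H}, bijective f.

Section ExtendedAffineA1.
Variables (R : realType) (nu : nat).

Local Notation V0 := 'rV[R]_nu.

Definition Zspan (A : set V0) : set V0 :=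
  [set v | exists (n : nat) (s : 'I_n -> V0) (c : 'I_n -> int),
    (forall i, A (s i)) /\ v = \sum_(i < n) s i *~ c i].

Definition semilattice (S : set V0) : Prop :=
  [/\ S 0,
      forall x y, S x -> S y -> S (x + y *+ 2) /\ S (x - y *+ 2),
      forall v : V0, exists2 X : seq V0,
        (forall x, x \in X -> S x) & v \in <<X>>%VS
    & S `<=` isolated S].

Definition Zbasis (sigma : 'I_nu -> V0) (L : set V0) : Prop :=
  Zspan (range sigma) = L /\
  (forall c : 'I_nu -> int,
     \sum_(i < nu) sigma i *~ c i = 0 -> forall i, c i = 0).

Definition tau (sigma : 'I_nu -> V0) (J : {set 'I_nu}) : V0 :=
  \sum_(j in J) sigma j.

Definition is_supp (sigma : 'I_nu -> V0) (S : set V0)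
    (D : {set {set 'I_nu}}) : Prop :=
  finset.set0 \in D /\
  S = \bigcup_(J in [set` D]) [set tau sigma J + l *+ 2 | l in Zspan S].

Definition has_index (sigma : 'I_nu -> V0) (S : set V0) (k : nat) : Prop :=
  exists2 D : {set {set 'I_nu}}, is_supp sigma S D & k = (#|D| - 1)%N.

(* (a, v, f) stands for a alpha_1 + v + f in R alpha_1 + V^0 + (V^0)^*.       *)
Definition Vtilde := (R^o * V0 * 'Hom(V0, R^o))%type.
HB.instance Definition _ := Vector.on Vtilde.

(* The pairing of V^0 and its dual is evaluation; for a basis sigma and its   *)
(* dual basis lambda this is (sigma_i, lambda_j) = delta_{i,j}.               *)
Definition form (x y : Vtilde) : R :=
  2 * (x.1.1 : R) * (y.1.1 : R) + (y.2 x.1.2 : R) + (x.2 y.1.2 : R).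

Definition alpha1 : Vtilde := (1, 0, 0).
Definition inV0 (v : V0) : Vtilde := (0, v, 0).

Definition root_system (S : set V0) : set Vtilde :=
  [set inV0 (s + t) | s in S & t in S] `|`
  [set alpha1 + inV0 s | s in S] `|` [set - alpha1 + inV0 s | s in S].

Definition nonisotropic (S : set V0) : set Vtilde :=
  [set a | root_system S a /\ form a a != 0].

Lemma form_inV0 (e d : R) (s t : V0) :
  form (e *: alpha1 + inV0 s) (d *: alpha1 + inV0 t) = 2 * e * d.
Proof.
by rewrite /form /= !scaler0 !add0r !lfunE /= !addr0 /GRing.scale /= !mulr1.
Qed.

Lemma nonisotropicE (S : set V0) : nonisotropic S =
  [set alpha1 + inV0 s | s in S] `|` [set - alpha1 + inV0 s | s in S].
Proof.
apply/seteqP; split=> [a [[[[s _ [t _ <-]]|Ra]|Ra]]|a [] [s Ss <-]].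
- by have := form_inV0 0 0 (s + t) (s + t); rewrite scale0r add0r mulr0 => ->;
    rewrite eqxx.
- by left.
- by right.
- split; first by left; right; exists s.
  by have := form_inV0 1 1 s s; rewrite scale1r !mulr1 => ->; rewrite pnatr_eq0.
- split; first by right; exists s.
  have := form_inV0 (-1) (-1) s s.
  by rewrite scaleN1r !mulrN1 opprK => ->; rewrite pnatr_eq0.
Qed.

Lemma nonisotropic_norm (S : set V0) a : nonisotropic S a -> form a a = 2.
Proof.
rewrite nonisotropicE => -[] [s Ss <-].
  by have := form_inV0 1 1 s s; rewrite scale1r !mulr1.
by have := form_inV0 (-1) (-1) s s; rewrite scaleN1r !mulrN1 opprK.
Qed.

Lemma formC x y : form x y = form y x.
Proof. by rewrite /form mulrAC -!addrA [X in _ + X]addrC. Qed.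

Lemma form_linear a : linear (form a : Vtilde -> R^o).
Proof.
move=> k x y; rewrite /form /= !lfunE /= !lfunE /= linearP /=.
by rewrite /GRing.scale /=; ring.
Qed.

Lemma nonisotropic_reflection (S : set V0) a : nonisotropic S a ->
  exists g : orthogonal_group form, orth_val g =1 reflection form a.
Proof.
by move=> /nonisotropic_norm; exact: (reflection_orthogonal formC form_linear).
Qed.

Definition weyl_group (S : set V0) : groupType :=
  generated_group (reflections form (nonisotropic S)).

Definition root_index (S : set V0) := {a : Vtilde | a \in nonisotropic S}.

Definition conj_rels (S : set V0) :
    set (seq (root_index S * bool) * seq (root_index S * bool)) :=
  [set r | (exists a, r = ([:: (a, false); (a, false)], [::])) \/
    (exists a b c, val c = reflection form (val a) (val b) /\
       r = ([:: (a, false); (b, false); (a, false)], [:: (c, false)]))].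

(* w_alpha(beta) is again a non-isotropic root, so in conj_rels every pair    *)
(* (alpha, beta) does give a relation.                                        *)
Lemma reflection_nonisotropic (S : set V0) a b : semilattice S ->
  nonisotropic S a -> nonisotropic S b -> nonisotropic S (reflection form a b).
Proof.
case=> S0 S2 _ _.
have SN s : S s -> S (- s).
  by move=> Ss; have [_] := S2 _ _ Ss Ss; rewrite mulr2n opprD addNKr.
have refE (e d : R) s t : reflection form (e *: alpha1 + inV0 s)
    (d *: alpha1 + inV0 t) = (d - 2 * d * e * e) *: alpha1
      + inV0 (t - (2 * d * e) *: s).
  rewrite /reflection form_inV0 scalerDr opprD addrACA scalerA scalerBl.
  congr (_ + _); apply/pair_equal_spec; split; last by rewrite /= scaler0 subr0.
  by apply/pair_equal_spec; split=> //=; rewrite scaler0 subr0.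
have sgn c : nonisotropic S c <-> exists (e : bool) s, S s /\
    c = (-1) ^+ e *: alpha1 + inV0 s.
  rewrite nonisotropicE; split=> [[] [s Ss <-]|[[] [s [Ss ->]]]].
  - by exists false, s; rewrite scale1r.
  - by exists true, s; rewrite scaleN1r.
  - by right; exists s; rewrite ?scaleN1r.
  - by left; exists s; rewrite ?scale1r.
move=> /sgn [e [s [Ss ->]]] /sgn [d [t [St ->]]]; apply/sgn; rewrite refE.
exists (~~ d), (t - (2 * (-1) ^+ d * (-1) ^+ e) *: s); split.
  have [Sp Sm] := S2 _ _ St Ss.
  rewrite -mulrA -signr_addb -scalerA; case: (d (+) e).
    by rewrite scaleN1r scalerN opprK scaler_nat.
  by rewrite scale1r scaler_nat.
suff -> : (-1) ^+ d - 2 * (-1) ^+ d * (-1) ^+ e * (-1) ^+ e =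
  (-1) ^+ (~~ d) :> R by [].
by rewrite -mulrA -expr2 sqrr_sign mulr1 signrN mulr_natl mulr2n opprD addNKr.
Qed.

Definition weyl_hat (S : set V0) : groupType := presented (@conj_rels S).

Definition has_presentation_by_conjugation (S : set V0) : Prop :=
  isomorphic (weyl_group S) (weyl_hat S).

End ExtendedAffineA1.

(* Main.v *)
From mathcomp Require Import all_boot all_order all_algebra.
From mathcomp Require Import all_classical all_reals all_analysis.
From mathcomp Require Import ring zify.
Require Import Defs.

(* The abelianizations of the two groups are elementary abelian 2-groups of   *)
(* different ranks.  The reflections of the Weyl group and the generators of  *)
(* its conjugation presentation fall into classes indexed by supp(S), on      *)
(* which homomorphisms to Z/2 are constant.  In the presented group the       *)
(* values on the ind(S) + 1 classes are arbitrary.  If supp(S) contains all   *)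
(* subsets of a three element set, then a product of eight reflections of the *)
(* Weyl group, one from each of the corresponding eight classes, is trivial,  *)
(* so there the values are constrained.  Such an S of index m exists as soon  *)
(* as m + 1 >= 8 + (nu - 3), the number of these subsets together with the    *)
(* remaining singletons.                                                      *)

Set Implicit Arguments.
Unset Strict Implicit.
Unset Printing Implicit Defensive.

Import Order.TTheory GRing.Theory Num.Theory.
Import numFieldNormedType.Exports.

Local Open Scope classical_set_scope.
Local Open Scope ring_scope.

(** An isomorphism transports homomorphisms to Z/2, so it suffices to count these. Take S to be
    [slat D] in Z^nu with [D] of size m + 1. On the presented group, counting modulo 2 the letters
    whose class lies in a chosen subset of [D] respects the relations ([conj_rels_parity]), which
    gives at least 2^(m+1) homomorphisms. On the Weyl group a homomorphism is determined by its
    values on the reflections in alpha_1 + tau_J, J in [D] ([weyl_character_eq],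
    [slat_character_parity]), and [weyl_octet] forbids it to be nonzero on the empty J alone. So
    there are fewer than 2^(m+1), and [character_count] concludes. *)

Definition is_character (G : groupType) (h : G -> bool) : Prop :=
  forall x y : G, h (x * y)%g = h x (+) h y.

Lemma character1 (G : groupType) (h : G -> bool) :
  is_character h -> h 1%g = false.
Proof. by move=> hM; have := hM 1%g 1%g; rewrite mulg1; case: (h 1%g). Qed.

Lemma characterV (G : groupType) (h : G -> bool) (x : G) :
  is_character h -> h (x^-1)%g = h x.
Proof.
move=> hM; have := hM x (x^-1)%g; rewrite mulgV character1//.
by case: (h x); case: (h _).
Qed.

(* The characters of [H] number at least [2 ^ #|D|], while those of [G] embed *)
(* in the subsets of [D] and miss the singleton of [J0].                      *)
Lemma character_count (G H : groupType) (I : finType) (D : {set I})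
    (g : I -> G) (chi : {set I} -> H -> bool) (J0 : I) :
  J0 \in D ->
  (forall h h' : G -> bool, is_character h -> is_character h' ->
    {in D, forall J, h (g J) = h' (g J)} -> h =1 h') ->
  (forall h : G -> bool, is_character h -> h (g J0) ->
    exists2 J, J \in D :\ J0 & h (g J)) ->
  (forall C : {set I}, is_character (chi C)) ->
  {in D, forall J, exists x : H, forall C, chi C x = (J \in C)} ->
  ~ isomorphic G H.
Proof.
move=> DJ0 gen rel chiM chiE [f [f' fK f'K]].
pose h C x := chi C (f x).
have hM C : is_character (h C) by move=> x y; rewrite /h gmulfM chiM.
pose Psi (C : {set I}) := [set J in D | h C (g J)].
(* Since [f] is onto, [chi C] can be recovered from its pullback [h C], hence so can [C]. *)
have Psi_inj : {in powerset D &, injective Psi}.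
  move=> C C'; rewrite !inE => /fintype.subsetP CD /fintype.subsetP CD' eqPsi.
  have hh : h C =1 h C'.
    apply: gen => // J DJ; have /setP/(_ J) := eqPsi.
    by rewrite !inE DJ.
  apply/setP => J; have [DJ|/negP DJ] := boolP (J \in D).
    have [x xE] := chiE J DJ.
    by rewrite -(xE C) -(xE C') -[x]f'K; exact: hh.
  by apply/idP/idP => [/CD|/CD'].
(* [Psi] would embed the powerset of [D] into itself with one element removed, against
   finiteness. *)
have PsiS : Psi @: powerset D \subset powerset D :\ [set J0]%SET.
  apply/fintype.subsetP => _ /imsetP[C _ ->]; rewrite !inE; apply/andP; split.
    apply/eqP => /setP E; have := E J0; rewrite !inE DJ0 eqxx /=.
    move=> /(rel _ (hM C))[J]; rewrite !inE => /andP[JJ0 DJ] hJ.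
    by have := E J; rewrite !inE DJ hJ (negPf JJ0).
  by apply/fintype.subsetP => J; rewrite inE => /andP[].
have := subset_leq_card PsiS; rewrite card_in_imset//.
rewrite (cardsD1 [set J0]%SET (powerset D)) inE finset.sub1set DJ0 add1n.
by rewrite ltnn.
Qed.

Lemma generated_ind (G : groupType) (A : set G)
    (P : generated_group A -> Prop) :
  P 1%g -> (forall x y, P x -> P y -> P (x / y)%g) ->
  (forall x, A (generated_val x) -> P x) -> forall x, P x.
Proof.
move=> P1 PV PA [x Ax].
(* Minimality of [generated A] concerns subsets of [G], so [P] is pushed forward to [G]. *)
pose Q y := exists2 z : generated_group A, generated_val z = y & P z.
suff [z zx Pz] : Q x by rewrite (_ : GeneratedGroup Ax = z)//; exact: val_inj.
have := Ax; rewrite !inE; apply; split; last first.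
  move=> y Ay; have gy : y \in generated A.
    by rewrite inE => H [_ AH]; exact: AH.
  by exists (GeneratedGroup gy) => //; exact: PA.
split; first by exists 1%g.
by move=> _ _ [y <- Py] [z <- Pz]; exists (y / z)%g => //; exact: PV.
Qed.

(** * The semilattice in Z^nu with prescribed support *)

Section Lattice.
Variables (R : realType) (nu : nat).
Local Notation V0 := 'rV[R]_nu.

Definition unit_vec (i : 'I_nu) : V0 := delta_mx 0 i.

Definition integral : set V0 := [set v | forall i, v 0 i \is a Num.int].

Lemma integralN v : integral v -> integral (- v).
Proof. by move=> iv i; rewrite mxE rpredN. Qed.

Lemma integralD v w : integral v -> integral w -> integral (v + w).
Proof. by move=> iv iw i; rewrite mxE rpredD. Qed.

Lemma integral_sum n (s : 'I_n -> V0) (c : 'I_n -> int) :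
  (forall i, integral (s i)) -> integral (\sum_(i < n) s i *~ c i).
Proof.
move=> si i; rewrite summxE rpred_sum// => j _.
rewrite -scaler_int mxE; apply: rpredM; [exact: (intr_int R)|exact: (si j i)].
Qed.

(** For integral [v] this is the set of odd coordinates, that is, the class of [v] modulo 2 Z^nu. *)
Definition parity (v : V0) : {set 'I_nu} :=
  [set i | (v 0 i / 2) \isn't a Num.int]%SET.

(** The union of the cosets tau_J + 2 Z^nu for J in [D], written as a condition on coordinates. *)
Definition slat (D : {set {set 'I_nu}}) : set V0 :=
  [set v | integral v /\ parity v \in D].

Lemma in_parity v i : (i \in parity v) = ((v 0 i / 2) \isn't a Num.int).
Proof. by rewrite finset.in_set. Qed.

Lemma parityN v : parity (- v) = parity v.
Proof. by apply/setP => i; rewrite !in_parity mxE mulNr rpredN. Qed.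

Lemma parityD v l : integral l -> parity (v + l *+ 2) = parity v.
Proof.
move=> il; apply/setP => i.
rewrite !in_parity mxE mulmxnE -[l 0 i *+ 2]mulr_natr mulrDl mulfK ?pnatr_eq0//.
by rewrite rpredDr// il.
Qed.

Lemma half_notin_int : (1 / 2 : R) \isn't a Num.int.
Proof.
apply/negP => /intrP[z /(congr1 ( *%R^~ 2))].
rewrite divfK ?pnatr_eq0// -[2]/(2%:~R) -[1]/(1%:~R) -intrM => /intr_inj; lia.
Qed.

Lemma tau_coord J i : tau unit_vec J 0 i = (i \in J)%:R.
Proof.
rewrite /tau summxE; under eq_bigr do rewrite mxE eqxx /= eq_sym.
case: (boolP (i \in J)) => iJ.
  rewrite (bigD1 i)//= eqxx big1 ?addr0// => j /andP[_ /negPf ji].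
  by rewrite ji.
by rewrite big1// => j jJ; case: eqP => // ji; rewrite -ji jJ in iJ.
Qed.

Lemma tau_integral J : integral (tau unit_vec J).
Proof. by move=> i; rewrite tau_coord rpred_nat. Qed.

Lemma parity_tau J : parity (tau unit_vec J) = J.
Proof.
apply/setP => i; rewrite in_parity tau_coord; case: (i \in J).
  exact: half_notin_int.
by rewrite mul0r rpred0.
Qed.

Lemma tau1 i : tau unit_vec [set i]%SET = unit_vec i.
Proof. exact: big_set1. Qed.

Lemma unit_vec_integral i : integral (unit_vec i).
Proof. by rewrite -tau1; exact: tau_integral. Qed.

Lemma parity_decomp v : integral v ->
  exists2 l, integral l & v = tau unit_vec (parity v) + l *+ 2.
Proof.
move=> iv; exists (\row_i ((v 0 i - (i \in parity v)%:R) / 2)).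
  move=> i; rewrite mxE in_parity.
  case: (boolP (v 0 i / 2 \is a Num.int)) => /= vi.
    by rewrite subr0.
  have /intrP[z vz] := iv i; rewrite vz in vi *.
  have [[w zw]|[w zw]] : {w | z = w * 2} + {w | z = w * 2 + 1}.
  - have := divz_eq z 2; have := modz_ge0 z (isT : 2%:Z != 0).
    have := ltz_pmod z (isT : 0 < 2%:Z); case: (z %% 2)%Z => [[|[|]]|]// _ _ ->.
      by left; exists (z %/ 2)%Z; rewrite addr0.
    by right; exists (z %/ 2)%Z.
  - by case/negP: vi; rewrite zw intrM mulfK ?pnatr_eq0// intr_int.
  - by rewrite zw intrD addrK intrM mulfK ?pnatr_eq0// intr_int.
apply/rowP => i; rewrite mxE mulmxnE mxE tau_coord -[X in _ + X]mulr_natr.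
by rewrite divfK ?pnatr_eq0// addrC subrK.
Qed.

Lemma Zspan_integral : Zspan (range unit_vec) = integral.
Proof.
apply/seteqP; split=> [_ [n [s [c [sE ->]]]]|v iv].
  by apply: integral_sum => i; have [j _ <-] := sE i; exact: unit_vec_integral.
exists nu, unit_vec, (fun i => Num.floor (v 0 i)).
split; first by move=> i; exists i.
rewrite [LHS]row_sum_delta; apply: eq_bigr => i _.
by rewrite -scaler_int floorK.
Qed.

(** Reduces invariance under all translations by 2 Z^nu to the translations by twice a basis
    vector. *)
Lemma integral_ind (P : V0 -> Prop) : P 0 ->
  (forall v i, P v -> P (v + unit_vec i) /\ P (v - unit_vec i)) ->
  forall v, integral v -> P v.
Proof.
move=> P0 PS v; rewrite -Zspan_integral => -[n [s [c [sE ->]]]].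
have Pn u i (k : nat) :
    P u -> P (u + unit_vec i *+ k) /\ P (u - unit_vec i *+ k).
  move=> Pu; elim: k => [|k [IH1 IH2]]; first by rewrite mulr0n subr0 addr0.
  rewrite !mulrSr opprD !addrA; split; first by have [] := PS _ i IH1.
  by have [] := PS _ i IH2.
elim/big_rec: _ => // i u _ Pu; have [j _ <-] := sE i; rewrite addrC.
by case: (c i) => k; [have [] := Pn _ j k Pu|have [] := Pn _ j k.+1 Pu].
Qed.

Lemma Zbasis_integral : Zbasis unit_vec integral.
Proof.
split=> [|c c0 i]; first exact: Zspan_integral.
have /rowP/(_ i) := c0; rewrite summxE mxE (bigD1 i)//= big1 => [|j ji].
  rewrite addr0 -scaler_int !mxE !eqxx mulr1 => /eqP.
  by rewrite intr_eq0 => /eqP.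
by rewrite -scaler_int !mxE eqxx eq_sym (negPf ji) mulr0.
Qed.

Lemma isolated_integral (S : set V0) : S `<=` integral -> S `<=` isolated S.
Proof.
move=> Sint v Sv; split; first exact/mem_set.
(* The norm is the sup norm, and distinct integers differ by at least 1. *)
exists (ball v 1); first exact: nbhsx_ballx.
apply/seteqP; split=> [w [/= [_ vw] Sw]|_ ->]; last by split; [exact: ballxx|].
apply/rowP => i; have := vw 0 i; rewrite /ball/=.
have /(_ i)/intrP[a ->] := Sint _ Sv.
have /(_ i)/intrP[b ->] := Sint _ Sw.
by rewrite -intrB -intr_norm -[1]/(1%:~R) ltr_int => ab; congr _%:~R; lia.
Qed.

Variable D : {set {set 'I_nu}}.
Hypotheses (D0 : finset.set0 \in D) (D1 : forall i, [set i]%SET \in D).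

Lemma slat0 : slat D 0.
Proof.
have -> : 0 = tau unit_vec finset.set0 by rewrite /tau big_set0.
by split; [exact: tau_integral|rewrite parity_tau].
Qed.

Lemma slat_tau J : J \in D -> slat D (tau unit_vec J).
Proof. by move=> DJ; split; [exact: tau_integral|rewrite parity_tau]. Qed.

Lemma slat_unit_vec i : slat D (unit_vec i).
Proof. by rewrite -tau1; exact: slat_tau. Qed.

Lemma slatD v l : slat D v -> integral l -> slat D (v + l *+ 2).
Proof.
move=> [iv Dv] il; split; last by rewrite parityD.
by rewrite mulr2n; do 2?apply: integralD.
Qed.

Lemma slatN v : slat D v -> slat D (- v).
Proof. by move=> [iv Dv]; split; [exact: integralN|rewrite parityN]. Qed.

Lemma Zspan_slat : Zspan (slat D) = integral.
Proof.
apply/seteqP; split=> [_ [n [s [c [sE ->]]]]|].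
  by apply: integral_sum => i; have [] := sE i.
rewrite -Zspan_integral => _ [n [s [c [sE ->]]]]; exists n, s, c; split=> // i.
by have [j _ <-] := sE i; exact: slat_unit_vec.
Qed.

Lemma semilattice_slat : semilattice (slat D).
Proof.
split; first exact: slat0.
- move=> x y Sx [iy _]; split; first exact: slatD.
  by rewrite -mulNrn; apply: slatD => //; exact: integralN.
- move=> v; exists (map unit_vec (enum 'I_nu)).
    by move=> _ /mapP[i _ ->]; exact: slat_unit_vec.
  rewrite [v]row_sum_delta; apply: rpred_sum => i _; apply: rpredZ.
  by apply: memv_span; apply: map_f; rewrite mem_enum.
- by apply: isolated_integral => v [].
Qed.

Lemma has_index_slat k : #|D| = k.+1 -> has_index unit_vec (slat D) k.
Proof.
move=> Dk; exists D; last by rewrite Dk subn1.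
split=> //; rewrite Zspan_slat.
apply/seteqP; split=> [v [iv Dv]|_ [J DJ [l il <-]]].
  have [l il vE] := parity_decomp iv.
  by exists (parity v) => //; exists l.
by apply: slatD => //; exact: slat_tau.
Qed.

End Lattice.

(** * Homomorphisms from a presented group to Z/2 *)

Section Presented.
Variables (X : choiceType) (rels : set (seq (X * bool) * seq (X * bool))).

(** The value on a word is the number, modulo 2, of letters satisfying [p]; a generator and its
    inverse count alike. *)
Lemma presented_character (p : pred X) :
  (forall u v, rels (u, v) ->
    odd (count (p \o fst) u) = odd (count (p \o fst) v)) ->
  exists2 h : presented rels -> bool, is_character h &
    forall x, h (\pi_(presented rels)%qT [:: (x, false)]) = p x.
Proof.
move=> pP; pose q (u : seq (X * bool)) := odd (count (p \o fst) u).
have qE u v : word_eq rels u v -> q u = q v.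
  elim=> {u v} [u v /pP//|x b|//|u v _ ->//|u v w _ -> _ ->//|].
    by rewrite /q /=; case: (p x).
  by move=> u u' v v' _ uu _ vv; rewrite /q !count_cat !oddD; congr (_ (+) _).
exists (fun x => q (repr x)) => [x y|x].
  rewrite (qE _ (repr x ++ repr y)) /q ?count_cat ?oddD//.
  exact: repr_word_eq.
rewrite (qE _ [:: (x, false)]) /q /=; first by case: (p x).
exact: repr_word_eq.
Qed.
End Presented.

(** * Reflections of the Weyl group and their relations *)

Section Weyl.
Variables (R : realType) (nu : nat).
Local Notation V0 := 'rV[R]_nu.

Definition root_refl (s : V0) : Vtilde R nu -> Vtilde R nu :=
  reflection (@form R nu) (alpha1 R nu + inV0 s).

Lemma root_reflE s a v f :
  root_refl s (a, v, f) = (- a - f s, v - (2 * a + f s) *: s, f).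
Proof.
rewrite /root_refl /reflection /form /=.
apply/pair_equal_spec; split; [apply/pair_equal_spec; split=> /=|].
- rewrite /GRing.scale /= !add0r !addr0 lfunE /= !mulr1; ring.
- by rewrite !add0r !addr0 lfunE /= !mulr1 addr0.
- by rewrite /= !addr0 scaler0 subr0.
Qed.

(** Opposite roots have the same reflection, so the roots alpha_1 + s account for all generators. *)
Lemma root_reflN s u :
  reflection (@form R nu) (- alpha1 R nu + inV0 s) u = root_refl (- s) u.
Proof.
rewrite /root_refl /reflection.
have -> : - alpha1 R nu + inV0 s = - (alpha1 R nu + inV0 (- s)).
  rewrite opprD; congr (_ + _).
  apply/pair_equal_spec; split; last by rewrite /= oppr0.
  by apply/pair_equal_spec; rewrite /= opprK oppr0.
set w := alpha1 R nu + _.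
have -> : form u (- w) = - form u w.
  by rewrite /form /= opp_lfunE linearN /= mulrN !opprD.
by rewrite scalerN scaleNr opprK.
Qed.

(** The reflection in alpha_1 + s sends alpha_1 + t to -(alpha_1 + 2s - t). *)
Lemma root_refl_conj s t u :
  root_refl s (root_refl t (root_refl s u)) = root_refl (s *+ 2 - t) u.
Proof.
case: u => [[a v] f]; rewrite (root_reflE s a) (root_reflE t) !root_reflE.
have -> : f (s *+ 2 - t) = f s *+ 2 - f t by rewrite linearB linearMn.
apply/pair_equal_spec; split=> //; apply/pair_equal_spec; split; first ring.
apply/rowP => i; rewrite !mxE; ring.
Qed.

(* The product of the reflections in [alpha1 + t_1], ..., [alpha1 + t_n], n   *)
(* even, is trivial as soon as the steps [(-1)^i t_i] form a closed path of   *)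
(* zero signed area; here the steps cover each class of [Z^3 / 2 Z^3] once.   *)
Lemma root_refl_octet a b c u :
  root_refl 0 (root_refl (b + c) (root_refl c (root_refl (a + c)
    (root_refl (a + b + c) (root_refl b (root_refl (a + b) (root_refl a u)))))))
  = u.
Proof.
case: u => [[x v] f]; rewrite (root_reflE a) (root_reflE (a + b)).
rewrite (root_reflE b) (root_reflE (a + b + c)) (root_reflE (a + c)).
rewrite (root_reflE c) (root_reflE (b + c)) (root_reflE 0).
have fD y z : f (y + z) = f y + f z by exact: linearD.
rewrite !fD linear0.
apply/pair_equal_spec; split=> //; apply/pair_equal_spec; split; first ring.
apply/rowP => i; rewrite !mxE; ring.
Qed.

Variable S : set V0.

Lemma weyl_ext (x y : weyl_group S) :
  orth_val (generated_val x) =1 orth_val (generated_val y) -> x = y.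
Proof. by move=> xy; do 2!apply: val_inj; exact/lfunP. Qed.

Lemma weyl_mulE (x y : weyl_group S) u :
  orth_val (generated_val (x * y)%g) u =
  orth_val (generated_val x) (orth_val (generated_val y) u).
Proof. exact: orth_mulE. Qed.

Lemma weyl_oneE u : orth_val (generated_val (1%g : weyl_group S)) u = u.
Proof. exact: orth_oneE. Qed.

Lemma weyl_reflection : exists r : V0 -> weyl_group S,
  forall s, S s -> orth_val (generated_val (r s)) =1 root_refl s.
Proof.
suff ex s : exists x : weyl_group S,
    S s -> orth_val (generated_val x) =1 root_refl s.
  by have [r rE] := choice ex; exists r.
(* Outside [S] the identity is a dummy value that makes [r] total. *)
have [Ss|nSs] := pselect (S s); last by exists 1%g.
have ns : nonisotropic S (alpha1 R nu + inV0 s).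
  by rewrite nonisotropicE; left; exists s.
have [g gE] := nonisotropic_reflection ns.
have gP : g \in generated (reflections (@form R nu) (nonisotropic S)).
  by rewrite inE => H [_ AH]; apply: AH; exists (alpha1 R nu + inV0 s).
by exists (GeneratedGroup gP).
Qed.

Variable r : V0 -> weyl_group S.
Hypothesis rE : forall s, S s -> orth_val (generated_val (r s)) =1 root_refl s.
Hypothesis SN : forall s, S s -> S (- s).

Lemma weyl_character_eq (h h' : weyl_group S -> bool) :
  is_character h -> is_character h' -> (forall s, S s -> h (r s) = h' (r s)) ->
  h =1 h'.
Proof.
move=> hM hM' hh; apply: (@generated_ind _ _ (fun x => h x = h' x)).
- by rewrite !character1.
- by move=> x y hx hy; rewrite hM hM' !characterV// hx hy.
- move=> x [a + xE]; rewrite nonisotropicE.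
  case=> [] [s Ss sa]; rewrite -{a}sa in xE.
    suff -> : x = r s by exact: hh.
    by apply: weyl_ext => u; rewrite xE rE.
  suff -> : x = r (- s) by apply: hh; exact: SN.
  by apply: weyl_ext => u; rewrite xE rE ?root_reflN//; exact: SN.
Qed.

Lemma weyl_character_conj (h : weyl_group S -> bool) s t :
  is_character h -> S s -> S t -> S (s *+ 2 - t) ->
  h (r (s *+ 2 - t)) = h (r t).
Proof.
move=> hM Ss St Sst; have -> : r (s *+ 2 - t) = (r s * r t * r s)%g.
  by apply: weyl_ext => u; rewrite !weyl_mulE !rE// root_refl_conj.
by rewrite !hM addbAC addbb.
Qed.

Lemma weyl_octet a b c :
  S 0 -> S a -> S b -> S c -> S (a + b) -> S (a + c) -> S (b + c) ->
  S (a + b + c) ->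
  (r 0 * (r (b + c)%R * (r c * (r (a + c)%R * (r (a + b + c)%R *
    (r b * (r (a + b)%R * r a)))))))%g = 1%g.
Proof.
move=> *; apply: weyl_ext => u; rewrite weyl_oneE -[RHS](root_refl_octet a b c).
by rewrite !weyl_mulE !rE.
Qed.
End Weyl.

Lemma set_extend (T : finType) (A : {set T}) n :
  (#|A| <= n <= #|T|)%N -> exists2 B : {set T}, A \subset B & #|B| = n.
Proof.
elim: n => [|n IHn] /andP[An nT].
  by exists A => //; apply/eqP; rewrite -leqn0.
have [|An'] := eqVneq #|A| n.+1; first by move=> An1; exists A.
have [|B AB Bn] := IHn; first by apply/andP; lia.
have /card_gt0P[x] : (0 < #|~: B|)%N by rewrite cardsCs finset.setCK Bn; lia.
rewrite inE => xB; exists (x |: B)%SET; last by rewrite cardsU1 xB Bn.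
exact: fintype.subset_trans AB (finset.subsetUr _ _).
Qed.

(** * Comparing the two groups for [slat D] *)

Section Semilattice.
Variables (R : realType) (nu : nat) (D : {set {set 'I_nu}}).
Hypotheses (D0 : finset.set0 \in D) (D1 : forall i, [set i]%SET \in D).

Local Notation S := (@slat R nu D).
Local Notation tau := (tau (@unit_vec R nu)).

(** Conjugation by [r 0] identifies the values at t and -t, and conjugation by [r u] then those at t
    and t + 2u; letting u run over basis vectors and their opposites reaches the whole coset. *)
Lemma slat_character_parity (r : 'rV[R]_nu -> weyl_group S)
    (h : weyl_group S -> bool) s :
  (forall s, S s -> orth_val (generated_val (r s)) =1 root_refl s) ->
  is_character h -> S s -> h (r s) = h (r (tau (parity s))).
Proof.
move=> rE hM Ss.
have SN t : S t -> S (- t) by exact: slatN.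
have hN t : S t -> h (r (- t)) = h (r t).
  move=> St; rewrite -[- t]add0r -[0 in LHS](mul0rn _ 2).
  apply: (weyl_character_conj rE) => //; rewrite ?mul0rn ?add0r.
    exact: slat0.
  exact: SN.
have hD t u : S t -> S u -> h (r (t + u *+ 2)) = h (r t).
  move=> St Su; rewrite -(hN _ St) addrC -[in LHS](opprK t).
  apply: (weyl_character_conj rE) => //; first exact: SN.
  by rewrite opprK addrC; apply: slatD => //; case: Su.
suff H l : integral l -> forall t, S t -> h (r (t + l *+ 2)) = h (r t).
  have [l il {1}->] := parity_decomp (proj1 Ss).
  by apply: H => //; apply: slat_tau; case: Ss.
move: l; apply: integral_ind => [t _|v i IH]; first by rewrite mul0rn addr0.
have Se : S (unit_vec R i) by exact: slat_unit_vec.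
split=> t St; rewrite mulrnDl addrCA addrC IH ?hD//.
- by apply: slatD => //; exact: unit_vec_integral.
- exact: SN.
- by apply: slatD => //; apply: integralN; exact: unit_vec_integral.
Qed.

(** In a conjugation relation the letter [a] occurs twice, and reflecting [b] in [a] moves its
    isotropic part by an element of 2 Z^nu. *)
Lemma conj_rels_parity (C : {set {set 'I_nu}}) u v :
  let p := fun a : root_index S => parity (val a).1.2 \in C in
  conj_rels (u, v) -> odd (count (p \o fst) u) = odd (count (p \o fst) v).
Proof.
have nsP a : nonisotropic S a -> exists e : bool, exists2 s, S s &
    a = (-1) ^+ e *: alpha1 R nu + inV0 s.
  rewrite nonisotropicE => -[] [s Ss <-].
    by exists false, s; rewrite ?scale1r.
  by exists true, s; rewrite ?scaleN1r.
move=> p [[a [-> ->]]|[a [b [c [cE [-> ->]]]]]] /=; first by case: (p a).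
suff -> : p c = p b by case: (p a); case: (p b).
rewrite /p cE; congr (_ \in C).
have [e [s [si _] ->]] := nsP _ (set_mem (valP a)).
have [d [t _ ->]] := nsP _ (set_mem (valP b)).
rewrite /reflection form_inV0 /= !scaler0 !add0r -mulrA -signr_addb -scalerA.
case: (d (+) e); rewrite ?scaleN1r ?scale1r scaler_nat.
  by rewrite -mulNrn opprK parityD.
by rewrite -mulNrn parityD//; exact: integralN.
Qed.

Lemma weyl_hat_character (C : {set {set 'I_nu}}) :
  exists chi : weyl_hat S -> bool, is_character chi /\
  forall a : root_index S,
    chi (\pi_(weyl_hat S)%qT [:: (a, false)]) = (parity (val a).1.2 \in C).
Proof.
by have [chi ? ?] := presented_character (@conj_rels_parity C); exists chi.
Qed.

Lemma slat_no_presentation (i j k : 'I_nu) :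
  i != j -> i != k -> j != k -> powerset [set i; j; k]%SET \subset D ->
  ~ has_presentation_by_conjugation S.
Proof.
move=> ij ik jk /fintype.subsetP AD.
have [r rE] := weyl_reflection S.
have [chi chiP] := choice weyl_hat_character.
apply: (@character_count _ _ _ D (fun J => r (tau J)) chi finset.set0) => //.
- move=> h h' hM hM' hh; apply: (weyl_character_eq rE) => // [|s Ss].
    exact: slatN.
  rewrite (slat_character_parity rE hM)// (slat_character_parity rE hM')//.
  by rewrite hh//; case: Ss.
(* If [h] vanishes on all classes but that of the empty set, applying it to the octet of the three
   basis vectors leaves only [h (r 0)], which must then vanish too. *)
- move=> h hM; apply: contraPP => noJ.
  pose A := [set i; j; k]%SET.
  have [Ai Aj Ak] : [/\ i \in A, j \in A & k \in A] by rewrite !inE !eqxx !orbT.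
  have SA (J : {set 'I_nu}) : J \subset A -> S (tau J).
    by move=> JA; apply: slat_tau; apply: AD; rewrite inE.
  have hA (J : {set 'I_nu}) x : x \in J -> J \subset A -> h (r (tau J)) = false.
    move=> xJ JA; apply/negbTE/negP => hJ; apply: noJ; exists J => //.
    rewrite !inE AD ?inE// andbT; apply/eqP => J0.
    by rewrite J0 inE in xJ.
  have e2 x y : x != y -> unit_vec R x + unit_vec R y = tau [set x; y]%SET.
    by move=> xy; rewrite /Defs.tau big_setU1 ?big_set1// inE.
  have e3 : unit_vec R i + unit_vec R j + unit_vec R k = tau A.
    rewrite /Defs.tau /A finset.setUC big_setU1 ?inE.
      by rewrite -/(Defs.tau _ _) e2// addrC.
    by rewrite negb_or !(eq_sym k) ik.
  have S2 x y : x \in A -> y \in A -> x != y -> S (unit_vec R x + unit_vec R y).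
    move=> Ax Ay xy; rewrite e2//; apply: SA.
    by rewrite finset.subUset !finset.sub1set Ax.
  have S1 := @slat_unit_vec R nu D D1.
  have h1 x : x \in A -> h (r (unit_vec R x)) = false.
    by move=> Ax; rewrite -tau1; apply: (hA _ x); rewrite ?inE// finset.sub1set.
  have h2 x y : x \in A -> y \in A -> x != y ->
      h (r (unit_vec R x + unit_vec R y)) = false.
    move=> Ax Ay xy; rewrite e2//; apply: (hA _ x); first by rewrite !inE eqxx.
    by rewrite finset.subUset !finset.sub1set Ax.
  have S3 : S (unit_vec R i + unit_vec R j + unit_vec R k).
    by rewrite e3; exact: SA.
  have h3 : h (r (unit_vec R i + unit_vec R j + unit_vec R k)) = false.
    by rewrite e3; exact: (hA _ i).
  have t0 : tau finset.set0 = 0 by rewrite /Defs.tau big_set0.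
  have /(congr1 h) := weyl_octet rE (slat0 R D0) (S1 i) (S1 j) (S1 k)
    (S2 _ _ Ai Aj ij) (S2 _ _ Ai Ak ik) (S2 _ _ Aj Ak jk) S3.
  by rewrite !hM character1// h3 !h1// !h2// !addbF t0 => ->.
- by move=> C; have [] := chiP C.
- move=> J DJ.
  have Ja : alpha1 R nu + inV0 (tau J) \in nonisotropic S.
    apply/mem_set; rewrite nonisotropicE; left.
    by exists (tau J) => //; exact: slat_tau.
  pose a : root_index S := exist (fun a => a \in nonisotropic S) _ Ja.
  exists (\pi_(weyl_hat S)%qT [:: (a, false)]) => C.
  by have [_ ->] := chiP C; rewrite /= add0r parity_tau.
Qed.

End Semilattice.

Theorem corollary5p18 (R : realType) (nu m : nat) :
  (3 <= nu)%N -> (nu + 4 <= m <= 2 ^ nu - 1)%N ->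
  exists (S : set 'rV[R]_nu) (sigma : 'I_nu -> 'rV[R]_nu),
    [/\ semilattice S,
        (forall i, S (sigma i)) /\ Zbasis sigma (Zspan S),
        has_index sigma S m
      & ~ has_presentation_by_conjugation S].
Proof.
move=> nu3 /andP[lem gem].
pose i : 'I_nu := Ordinal (ltnW (ltnW nu3)).
pose j : 'I_nu := Ordinal (ltnW nu3).
pose k : 'I_nu := Ordinal nu3.
pose A := [set i; j; k]%SET.
have cA : #|A| = 3%N by rewrite /A finset.setUC cardsU1 cards2 !inE.
(* The subsets of [A] supply the octet; the other singletons put the whole standard basis into S.
   The size is at most 8 + (nu - 3) = nu + 5. *)
pose E := (powerset A :|: [set [set x] | x in ~: A])%SET.
have cE : (#|E| <= m.+1 <= #|{set 'I_nu}|)%N.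
  apply/andP; split; last first.
    rewrite -cardsT -powersetT card_powerset cardsT card_ord.
    by have := expn_gt0 2 nu; lia.
  have [+ _] := leq_card_setU (powerset A) [set [set x] | x in ~: A]%SET.
  have := leq_imset_card (fun x : 'I_nu => [set x]%SET) (~: A)%SET.
  have cC : #|~: A|%SET = (nu - 3)%N.
    by rewrite cardsCs finset.setCK cA card_ord.
  rewrite card_powerset cC cA => cS cU; apply: leq_trans cU _.
  by apply: leq_trans (leq_add (leqnn _) cS) _; lia.
have [D ED Dm] := set_extend cE.
have AD : powerset A \subset D.
  exact: fintype.subset_trans (finset.subsetUl _ _) ED.
have D0 : finset.set0 \in D.
  by apply: (fintype.subsetP AD); rewrite inE finset.sub0set.
have D1 x : [set x]%SET \in D.
  have [xA|xA] := boolP (x \in A).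
    by apply: (fintype.subsetP AD); rewrite inE finset.sub1set.
  apply: (fintype.subsetP ED); rewrite inE; apply/orP; right.
  by apply: imset_f; rewrite inE.
exists (slat D), (@unit_vec R nu); split.
- exact: semilattice_slat.
- split; first exact: slat_unit_vec.
  by rewrite Zspan_slat//; exact: Zbasis_integral.
- exact: has_index_slat.
- exact: (@slat_no_presentation R nu D D0 D1 i j k).
Qed.
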